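(* Let $r\ge 0$ and $k$ be integers with $0\le k\le r$. Consider pairs of families $\mathcal{A}\subset\mathbb{N}^{(r)}$, $\mathcal{B}\subset\mathbb{N}^{(r-1)}$ such that every $A\in\mathcal{A}$ contains at least $k$ distinct members of $\mathcal{B}$ as subsets, and write $a=|\mathcal{A}|$, $b=|\mathcal{B}|$. Then: (i) If $k=0$, the minimum possible value of $b$ is $0$, for every value of $a$. (ii) If $k=1$, the minimum possible value of $b$ is $1$ if $a\ge 1$, and $0$ if $a=0$. (iii) If $k=2$, then $f(r,2,b)=\binom{b}{2}$ for every integer $b\ge 0$. (iv) If $k=3$, then for all integers $c_2>c_1\ge 0$ with $c_2\ge 29$, \[f\left(r,3,\binom{c_2}{2}+\binom{c_1}{1}\right)=\binom{c_2}{3}+\binom{c_1}{2}.\]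
   Context: $\mathbb{N}^{(s)}$ denotes the family of all $s$-element subsets of $\mathbb{N}$. For integers $0\le k\le r$ and $b\ge 0$, $f(r,k,b)$ denotes the maximum of $|\mathcal{A}|$ over all pairs of families $\mathcal{A}\subset\mathbb{N}^{(r)}$, $\mathcal{B}\subset\mathbb{N}^{(r-1)}$ with $|\mathcal{B}|=b$ such that for every $A\in\mathcal{A}$ there exist $k$ distinct sets $B_1,\dots,B_k\in\mathcal{B}$ with $B_i\subset A$ for all $i$. Binomial coefficients $\binom{c}{i}$ with $c<i$ are $0$. *)

(* Defs.v *)
From mathcomp Require Import all_boot.
From mathcomp Require Export finmap.
Set Implicit Arguments. Unset Strict Implicit. Unset Printing Implicit Defensive.
Local Open Scope fset_scope.

Definition uniform (s : nat) (F : {fset {fset nat}}) : Prop :=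
  forall X, X \in F -> #|` X| = s.

(* (A, B) is an admissible pair for parameters r, k:
   A is a finite subfamily of N^(r), B a finite subfamily of N^(r-1)
   (empty when r = 0, since N^(-1) is empty), and every A in A contains
   at least k distinct members of B. *)
Definition admissible (r k : nat) (A B : {fset {fset nat}}) : Prop :=
  [/\ uniform r A, uniform r.-1 B, (r = 0 -> B = fset0) &
      forall X, X \in A -> k <= #|` [fset Y in B | Y `<=` X]|].

Definition min_b (r k a m : nat) : Prop :=
  (exists A B, admissible r k A B /\ #|` A| = a /\ #|` B| = m) /\
  (forall A B, admissible r k A B -> #|` A| = a -> m <= #|` B|).

Definition f_is (r k b m : nat) : Prop :=
  (exists A B, admissible r k A B /\ #|` B| = b /\ #|` A| = m) /\
  (forall A B, admissible r k A B -> #|` B| = b -> #|` A| <= m).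

(* Main.v *)
Require Import Defs.
From mathcomp Require Import all_boot.
From mathcomp Require Import finmap.
From Stdlib Require Import NArith ZArith Lia.
From mathcomp Require Import zify.

(* For k = 2, two distinct members of B lie in at most one member of A, namely
   their union, so |A| <= C(|B|, 2).

   For k = 3, a vertex v splits B into its link (of size d) and its deletion (of
   size h = |B| - d), and the members of A into p avoiding v, x having exactly
   two members of B through v below them, and y having at least three.
   Induction on |B|, then on the rank, bounds p and y; moreover x <= h, because
   A \ v lies in B when A is counted by x, and x + 3 y <= C(d, 2), because pairs in
   the link determine A; finally, if x > 0, adding one set to the link increases
   y, so that y + 1 obeys the bound for d + 1. Counting triples (v, A, pair in
   the link of v) gives 3 (r - 2) |A| <= sum_v (x + 3 y), while
   sum_v d = (r - 1) |B|. When r >= 4 it therefore suffices that for each d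
   either p + x + y <= U(|B|) or (x + 3 y) |B| <= 2 d U(|B|), where U is the
   asserted bound (weakened to Lovasz's for |B| < 351, where the exact bound
   cannot be carried through the induction). When r = 3, the statement is about
   triangles in graphs, and deleting a vertex of small degree suffices. *)

(** * Estimates for large families *)

Section Estimates.
Local Open Scope Z_scope.

(* For [n = x (x - 1) / 2] with [x >= 1] real, this says
   [0 <= u <= x (x - 1) (x - 2) / 6]. *)
Definition lovasz (n u : Z) := 0 <= u /\ (6 * u + 3 * n) ^ 2 <= n ^ 2 * (8 * n + 1).

(* The tangent at [p / q] of the square root in Lovasz's bound, via AM-GM. *)
Lemma lovasz_tangent n u p q : 0 < n -> lovasz n u ->
  2 * (6 * u + 3 * n) * (p * q) <= n * (q ^ 2 * (8 * n + 1) + p ^ 2).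
Proof.
intros n_gt0 [_ H].
assert (AGM : 2 * (q * (6 * u + 3 * n)) * (n * p) <= (q * (6 * u + 3 * n)) ^ 2 + (n * p) ^ 2).
{ pose proof (Z.square_nonneg (q * (6 * u + 3 * n) - n * p)). lia. }
assert (q ^ 2 * (6 * u + 3 * n) ^ 2 <= q ^ 2 * (n ^ 2 * (8 * n + 1))).
{ apply Z.mul_le_mono_nonneg_l; [apply Z.pow_even_nonneg; exists 1; lia | assumption]. }
apply (Z.mul_le_mono_pos_l _ _ n n_gt0). lia.
Qed.

(** Four times the gap in the squared inequality factors as [e * (c - e)] times a nonnegative
    polynomial: it vanishes when [n] is exactly a binomial coefficient. *)
Lemma kk_lovasz c e : 0 <= e < c ->
  forall n u, 2 * n = c * (c - 1) + 2 * e -> 6 * u = c * (c - 1) * (c - 2) + 3 * e * (e - 1) ->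
  lovasz n u.
Proof.
intros He n u Hn Hu.
split.
- assert (0 <= c * (c - 1) * (c - 2)).
  { destruct (Z.eq_dec c 1); [subst; lia|]. repeat apply Z.mul_nonneg_nonneg; lia. }
  assert (0 <= e * (e - 1)) by nia. lia.
- assert (X : 0 <= (2 * n) ^ 2 * (4 * (2 * n) + 1) - (2 * (6 * u) + 3 * (2 * n)) ^ 2).
  { rewrite Hu Hn.
    match goal with |- 0 <= ?t => replace t with
      (e * (c - e) *
       (36 * e ^ 2 + (36 * c - 32) * e + (c - 1) * (24 * (c * (c - 1)) + 4))) by ring end.
    repeat apply Z.mul_nonneg_nonneg; try lia.
    assert (0 <= c * (c - 1)) by (apply Z.mul_nonneg_nonneg; lia).
    assert (0 <= (36 * c - 32) * e) by (apply Z.mul_nonneg_nonneg; lia).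
    assert (0 <= (c - 1) * (24 * (c * (c - 1)) + 4)) by (apply Z.mul_nonneg_nonneg; lia).
    assert (0 <= e ^ 2) by (apply Z.pow_even_nonneg; exists 1; lia). lia. }
  lia.
Qed.

(* Here [F] is the bound asserted for a family of [b] sets. The vertex degree is
   [d], and [h = b - d]. *)
Section Large.
Variables (c e b F : Z).
Hypotheses (Hc : 36 <= c) (He : 0 <= e < c) (Hb : 2 * b = c * (c - 1) + 2 * e)
  (HF : 6 * F = c * (c - 1) * (c - 2) + 3 * e * (e - 1)).

Lemma b_ge0 : 0 <= b.
Proof. assert (0 <= c * (c - 1)) by (apply Z.mul_nonneg_nonneg; lia). lia. Qed.

(** A lower bound on [F / b] uniform in [e]: six times the gap equals
    [8 (3 e - c)^2 + c (c - 9) + 42 e]. *)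
Lemma kk_ratio : b * (8 * c - 19) <= 24 * F.
Proof.
assert (0 <= (3 * e - c) ^ 2) by (apply Z.pow_even_nonneg; exists 1; lia).
assert (0 <= c * (c - 9)) by (apply Z.mul_nonneg_nonneg; lia).
assert (2 * b * (8 * c - 19) <= 8 * (6 * F)); [rewrite Hb HF|]; lia.
Qed.

(** With [q = x + 3 y], counting pairs in the link is enough while [d - 1] stays below [4 F / b],
    which is about [4 c / 3]. *)
Lemma ratio_small d q : 0 <= d -> 6 * d <= 8 * c - 13 -> 2 * q <= d * (d - 1) -> b * q <= 2 * d * F.
Proof.
intros H1 H2 H3. pose proof kk_ratio as K.
pose proof b_ge0.
assert (b * (6 * (d - 1)) <= b * (8 * c - 19)) by (apply Z.mul_le_mono_nonneg_l; lia).
assert (b * (2 * q) <= b * (d * (d - 1))) by (apply Z.mul_le_mono_nonneg_l; lia).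
assert (d * (b * (d - 1)) <= d * (4 * F)) by (apply Z.mul_le_mono_nonneg_l; lia).
lia.
Qed.

(** Beyond about [4 c / 3] the quadratic pair count is too weak. It is replaced by [x <= h] and
    [y <= u], where [u] grows only like [d^(3/2)]. *)
Lemma ratio_mid d u q : 8 * c - 12 <= 6 * d -> 8 * d <= c ^ 2 -> lovasz d u ->
  q <= b - d + 3 * u -> b * q <= 2 * d * F.
Proof.
intros H1 H2 Hu Hq. pose proof kk_ratio as K.
pose proof b_ge0.
assert (b_le : 2 * b <= (c - 1) * (c + 2)) by lia.
enough (R : 12 * (b - d + 3 * u) <= d * (8 * c - 19)).
{ assert (b * (12 * q) <= b * (d * (8 * c - 19))) by (apply Z.mul_le_mono_nonneg_l; lia).
  assert (d * (b * (8 * c - 19)) <= d * (24 * F)) by (apply Z.mul_le_mono_nonneg_l; lia).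
  lia. }
destruct (Z_le_dec d (3 * c)) as [Hd|Hd].
(* The slope 20 approximates [sqrt (8 d + 1)] near [d = 50], the low end of the range when
   [c = 36]. *)
- pose proof (lovasz_tangent d u 20 1 ltac:(lia) Hu).
  assert (240 * u <= d * (8 * d + 281)) by lia.
  enough (240 * b <= d * (160 * c - 983 - 24 * d)) by lia.
  assert (0 <= (3 * c - d) * (6 * d - (8 * c - 12))) by (apply Z.mul_nonneg_nonneg; lia).
  assert ((8 * c - 12) * (56 * c - 935) <= 6 * d * (56 * c - 935))
    by (apply Z.mul_le_mono_nonneg_r; lia).
  assert (36 * c <= c * c) by nia.
  lia.
- pose proof (lovasz_tangent d u c 1 ltac:(lia) Hu).
  assert (d * (8 * d) <= d * c ^ 2) by (apply Z.mul_le_mono_nonneg_l; lia).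
  assert (12 * u * c <= d * (2 * c ^ 2 + 1 - 6 * c)) by lia.
  enough (12 * b * c <= d * (2 * c ^ 2 + 11 * c - 3)) by (apply (Z.mul_le_mono_pos_r _ _ c); lia).
  assert (3 * c * (2 * c ^ 2 + 11 * c - 3) <= d * (2 * c ^ 2 + 11 * c - 3))
    by (apply Z.mul_le_mono_nonneg_r; nia).
  assert (6 * c * (2 * b) <= 6 * c * ((c - 1) * (c + 2))) by (apply Z.mul_le_mono_nonneg_l; lia).
  nia.
Qed.

(** For large links the first alternative [p + x + y <= F] holds. Tangents turn the Lovasz bounds
    into quadratics in [d] and [h], and explicit nonnegative combinations conclude. *)
Lemma sum_large d h ud uh : c ^ 2 <= 8 * d -> c <= h -> h + d = b ->
  lovasz d ud -> lovasz h uh -> uh + h + ud <= F.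
Proof.
intros H1 H2 H3 Hd Hh.
assert (c2 : 36 * c <= c * c) by (apply Z.mul_le_mono_nonneg_r; lia).
assert (D2 : 2 * d = c * (c - 1) + 2 * e - 2 * h) by lia.
destruct (Z_le_dec (8 * h) (c ^ 2)) as [Hs|Hs].
(* The tangent points are [d = C(c, 2)], where [sqrt (8 d + 1) = 2 c - 1], and [h] about
   [c^2 / 8]. *)
- pose proof (lovasz_tangent d ud (2 * c - 1) 1 ltac:(lia) Hd) as T1.
  pose proof (lovasz_tangent h uh c 1 ltac:(lia) Hh) as T2.
  assert (T2' : (2 * c - 1) * (12 * uh * c) <= (2 * c - 1) * (h * (8 * h + 1 + c ^ 2 - 6 * c)))
    by (apply Z.mul_le_mono_nonneg_l; lia).
  assert (T1' : 2 * c * (12 * ud * (2 * c - 1)) <=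
      c * ((2 * d) * (4 * (2 * d) + 1 + (2 * c - 1) ^ 2 - 6 * (2 * c - 1)))).
  { replace (c * _) with (2 * c * (d * (8 * d + 1 + (2 * c - 1) ^ 2 - 6 * (2 * c - 1)))) by ring.
    apply Z.mul_le_mono_nonneg_l; lia. }
  rewrite D2 in T1'.
  assert (E : 0 <= 4 * c * (2 * c - 1) * (6 * F) - 24 * c * (2 * c - 1) * h
    - 2 * ((2 * c - 1) * (h * (8 * h + 1 + c ^ 2 - 6 * c)))
    - c * ((c * (c - 1) + 2 * e - 2 * h) * (4 * (c * (c - 1) + 2 * e - 2 * h) + 1
         + (2 * c - 1) ^ 2 - 6 * (2 * c - 1)))).
  { rewrite HF.
    match goal with |- 0 <= ?t => replace t with
      (6 * (c * h * (c ^ 2 - 8 * h)) + 14 * (c * c * (h - c) * (c - 5)) + 6 * (c * (2 * e - c)) ^ 2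
       + 28 * (c * (c - e) * (c + e)) + 16 * (h * h) + 32 * (h * c * e) + 24 * (h * c) + 2 * h
       + 4 * ((c - 1) * c * e) + 20 * (c * c * e) + 2 * (c * c * c * (4 * c - 49))) by ring end.
    assert (0 <= (c * (2 * e - c)) ^ 2) by (apply Z.pow_even_nonneg; exists 1; lia).
    repeat apply Z.add_nonneg_nonneg; try (apply Z.mul_nonneg_nonneg; [lia|assumption]);
      repeat apply Z.mul_nonneg_nonneg; lia. }
  apply (Z.mul_le_mono_pos_l _ _ (4 * c * (2 * c - 1) * 6));
    [apply Z.mul_pos_pos; [apply Z.mul_pos_pos|]; lia|].
  apply Z.le_0_sub; apply Z.le_0_sub in T1'; apply Z.le_0_sub in T2'.
  pose proof (Z.add_nonneg_nonneg _ _ E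
    (Z.add_nonneg_nonneg _ _ T1' (Z.add_nonneg_nonneg _ _ T2' T2'))) as X.
  eapply Z.le_trans; [exact X|apply Z.eq_le_incl; ring].
(* Both sizes now lie between [c^2 / 8] and about [3 c^2 / 8], where [sqrt (8 n)] is close to
   [7 c / 4]. The product [f1] bounds [h^2 + d^2] for the given sum [h + d]. *)
- pose proof (lovasz_tangent d ud (7 * c) 4 ltac:(lia) Hd) as T1.
  pose proof (lovasz_tangent h uh (7 * c) 4 ltac:(lia) Hh) as T2.
  assert (f1 : 0 <= (8 * h - c ^ 2) * (8 * d - c ^ 2)) by (apply Z.mul_nonneg_nonneg; lia).
  assert (f3 : 0 <= c * (8 * d - c ^ 2)) by (apply Z.mul_nonneg_nonneg; lia).
  assert (f2 : 672 * c * (uh + ud) + 672 * c * h <=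
    64 * (2 * (h + d)) ^ 2 - 4 * (8 * c ^ 2 * (2 * (h + d)) - 2 * c ^ 4)
    + 16 * (2 * (h + d)) + 49 * c ^ 2 * (2 * (h + d)) + 168 * c * (2 * (h + d)) - 84 * c ^ 3).
  { apply Z.le_0_sub; apply Z.le_0_sub in T1; apply Z.le_0_sub in T2.
    assert (X : 0 <=
       2 * (d * (4 ^ 2 * (8 * d + 1) + (7 * c) ^ 2) - 2 * (6 * ud + 3 * d) * (7 * c * 4))
       + 2 * (h * (4 ^ 2 * (8 * h + 1) + (7 * c) ^ 2) - 2 * (6 * uh + 3 * h) * (7 * c * 4))
       + 8 * ((8 * h - c ^ 2) * (8 * d - c ^ 2)) + 84 * (c * (8 * d - c ^ 2))).
    { repeat apply Z.add_nonneg_nonneg; (apply Z.mul_nonneg_nonneg; [lia|assumption]). }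
    eapply Z.le_trans; [exact X|apply Z.eq_le_incl; ring]. }
  rewrite H3 Hb in f2.
  assert (E : 0 <= 112 * c * (6 * F) - (64 * (c * (c - 1) + 2 * e) ^ 2
    - 4 * (8 * c ^ 2 * (c * (c - 1) + 2 * e) - 2 * c ^ 4)
    + 16 * (c * (c - 1) + 2 * e) + 49 * c ^ 2 * (c * (c - 1) + 2 * e)
    + 168 * c * (c * (c - 1) + 2 * e) - 84 * c ^ 3)).
  { rewrite HF.
    match goal with |- 0 <= ?t => replace t with
      (336 * ((c - 1) * e * e) + 80 * (e * e) + 290 * (c * c * (c - e))
       + 416 * (c * (c - e)) + 32 * (c - e)
       + c * c * c * (23 * c - 565) + c * (-104 * c - 16)) by ring end.
    assert (0 <= c * c * c * (23 * c - 565) - 36 * 36 * c * (23 * c - 565)).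
    { replace (_ - _) with ((c * c - 36 * 36) * c * (23 * c - 565)) by ring.
      repeat apply Z.mul_nonneg_nonneg; lia. }
    assert (0 <= (c - 1) * e * e) by (repeat apply Z.mul_nonneg_nonneg; lia).
    assert (0 <= c * c * (c - e)) by (repeat apply Z.mul_nonneg_nonneg; lia).
    assert (0 <= c * (c - e)) by (repeat apply Z.mul_nonneg_nonneg; lia).
    assert (0 <= e * e) by (repeat apply Z.mul_nonneg_nonneg; lia).
    assert (0 <= c * (1296 * (23 * c - 565) - 104 * c - 16)) by (apply Z.mul_nonneg_nonneg; lia).
    lia. }
  apply (Z.mul_le_mono_pos_l _ _ (112 * c * 6)); [lia|].
  apply Z.le_0_sub; apply Z.le_0_sub in f2.
  eapply Z.le_trans; [exact (Z.add_nonneg_nonneg _ _ E f2)|apply Z.eq_le_incl; ring].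
Qed.
End Large.

End Estimates.

Set Implicit Arguments.
Unset Strict Implicit.
Unset Printing Implicit Defensive.

(** * The bound for small families *)

(* The largest [u] with [lovasz n u]. *)
Definition lovN (n : N) : N := ((N.sqrt (n * n * (8 * n + 1)) - 3 * n) / 6)%num.

(* [C(c, 3) + C(e, 2)] where [n = C(c, 2) + e] and [e < c]. *)
Definition kkN (n : N) : N :=
  (let c := (N.sqrt (8 * n + 1) + 1) / 2 in let e := n - c * (c - 1) / 2 in
   c * (c - 1) * (c - 2) / 6 + e * (e - 1) / 2)%num.

(* With an earlier switch to [kkN], say at [C(26, 2)] instead of [351 = C(27, 2)],
   [check] would fail. *)
Definition bndN (n : N) : N := if (n <? 351)%num then lovN n else kkN n.

(* Each test suffices for the dichotomy of [check_sound]; [Ub], [Uh], [Ud], [Ud1]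
   are the values of the bound at [b], [b - d], [d], [d + 1]. *)
Definition check (b d Ub Uh Ud Ud1 : N) : bool :=
  (let h := b - d in
   if Uh + h + Ud <=? Ub then true else
   if b * (d - 1) <=? 4 * Ub then true else
   if b * (h + 3 * Ud) <=? 2 * d * Ub then true else
   if 6 * Uh + 4 * h + d * (d - 1) <? 6 * Ub + 6 then true else
   if Uh + Ud <=? Ub then Uh + h + Ud1 <=? Ub + 1 else false)%num.

(* The lists hold the values of the bound at [d], [d + 1], ... and at [b - d],
   [b - d - 1], ..., so that no value is recomputed. *)
Fixpoint row (b Ub d : N) (fw bw : seq N) : bool :=
  if bw is Uh :: bw' then
    if fw is Ud :: fw' then
      if fw' is Ud1 :: _ then
        if check b d Ub Uh Ud Ud1 then row b Ub (d + 1)%num fw' bw' else false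
      else false
    else false
  else true.

Fixpoint table (b : N) (fw cur bw : seq N) (n : nat) : bool :=
  if n is n'.+1 then
    if cur is Ub :: cur' then
      if row b Ub 1%num fw bw then table (b + 1)%num fw cur' (Ub :: bw) n' else false
    else false
  else true.

Fixpoint bnds (n : nat) (i : N) : seq N :=
  if n is n'.+1 then bndN i :: bnds n' (i + 1)%num else [::].

Fixpoint bnds_down (n : nat) : seq N :=
  if n is n'.+1 then bndN (N.of_nat n) :: bnds_down n' else [::].

Lemma row_check b Ub k m d : k < m ->
  row b Ub (N.of_nat d) (bnds m (N.of_nat d)) (bnds_down k) -> forall j, j < k ->
  check b (N.of_nat (d + j)) Ub (bndN (N.of_nat (k - j))) (bndN (N.of_nat (d + j)))
    (bndN (N.of_nat (d + j).+1)).
Proof.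
elim: k m d => [|k IH] [|[|m]] d //= lt_k_m.
have -> : (N.of_nat d + 1)%num = N.of_nat d.+1 by lia.
case: ifP => // chk /(IH m.+1 d.+1 lt_k_m) rest [|j] lt_j; first by rewrite addn0 subn0.
by rewrite addnS -addSn subSS; apply: rest.
Qed.

Lemma table_row fw n m b : n <= m ->
  table (N.of_nat b.+1) fw (bnds m (N.of_nat b.+1)) (bnds_down b) n -> forall i, i < n ->
  row (N.of_nat (b + i).+1) (bndN (N.of_nat (b + i).+1)) 1%num fw (bnds_down (b + i)).
Proof.
elim: n m b => [|n IH] [|m] b //= le_n_m; case: ifP => // rowb.
have -> : N.pos (Pos.of_succ_nat b + 1) = N.of_nat b.+2 by lia.
move=> tab [|i] lt_i; first by rewrite addn0.
rewrite addnS -addSn; exact: (IH m b.+1).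
Qed.

Lemma table_check n b d :
  table 1%num (bnds n.+1 1%num) (bnds n 1%num) [::] n -> 0 < d < b -> b <= n ->
  check (N.of_nat b) (N.of_nat d) (bndN (N.of_nat b)) (bndN (N.of_nat (b - d)))
    (bndN (N.of_nat d)) (bndN (N.of_nat d.+1)).
Proof.
move=> tab /andP[d_gt0 lt_d_b] b_le.
case: b lt_d_b b_le => // b lt_d_b b_le; case: d d_gt0 lt_d_b => // d _ lt_d_b.
have rw := @table_row (bnds n.+1 1%num) n n 0 (leqnn _) tab b b_le.
by have := @row_check _ _ _ n.+1 1 (ltnW b_le) rw d lt_d_b; rewrite add0n add1n subSS.
Qed.

(** [629] is [C(36, 2) - 1]: from [C(36, 2)] on, the estimates for [c >= 36] take over. *)
Lemma table_true : table 1%num (bnds 630 1%num) (bnds 629 1%num) [::] 629.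
Proof. by vm_cast_no_check (erefl true). Qed.

(** The second test uses the pair count, the third [x <= h] and [y <= Ud]. The fourth writes
    [6 (p + x + y)] as [6 p + 4 x + 2 (x + 3 y)]. The last treats [x = 0] and [x > 0] separately,
    with [y < Ud1] in the latter case. *)
Lemma check_sound (b d Ub Uh Ud Ud1 p x y : N) : (d < b)%num -> check b d Ub Uh Ud Ud1 ->
  (p <= Uh -> x <= b - d -> y <= Ud -> 2 * (x + 3 * y) <= d * (d - 1) ->
   (0 < x -> y + 1 <= Ud1) -> p + x + y <= Ub \/ b * (x + 3 * y) <= 2 * d * Ub)%num.
Proof.
move=> lt_d_b; rewrite /check.
case: N.leb_spec => [|_]; first by left; lia.
case: N.leb_spec => [? _ pU xh yU pairs _|_]; first by right; nia.
case: N.leb_spec => [? _ pU xh yU pairs _|_]; first by right; nia.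
case: N.ltb_spec => [? _ pU xh yU pairs _|_]; first by left; lia.
case: N.leb_spec => // ?; case: N.leb_spec => // ? _ pU xh yU _ ext; left.
case: (N.eq_0_gt_0_cases x) => [->|/ext]; lia.
Qed.

(** * The exact bound and Lovasz's bound on natural numbers *)

Definition bnd (n : nat) : nat := N.to_nat (bndN (N.of_nat n)).
Definition kk (n : nat) : nat := N.to_nat (kkN (N.of_nat n)).

Lemma bin2Z c : (2 * Z.of_nat 'C(c, 2) = Z.of_nat c * (Z.of_nat c - 1))%Z.
Proof. by elim: c => [//|c IH]; rewrite binS bin1; lia. Qed.

Lemma bin3Z c :
  (6 * Z.of_nat 'C(c, 3) = Z.of_nat c * (Z.of_nat c - 1) * (Z.of_nat c - 2))%Z.
Proof. by elim: c => [//|c IH]; rewrite binS; have := bin2Z c; lia. Qed.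

Lemma bin2N c : (N.of_nat c * (N.of_nat c - 1) / 2 = N.of_nat 'C(c, 2))%num.
Proof.
symmetry; apply: (N.div_unique _ _ _ 0) => //; case: c => // c; have := bin2Z c.+1.
by rewrite (_ : N.of_nat c.+1 - 1 = N.of_nat c)%num; lia.
Qed.

Lemma bin3N c : (N.of_nat c * (N.of_nat c - 1) * (N.of_nat c - 2) / 6 = N.of_nat 'C(c, 3))%num.
Proof.
symmetry; apply: (N.div_unique _ _ _ 0) => //; case: c => [|[|c]] //; have := bin3Z c.+2.
have -> : (N.of_nat c.+2 - 1 = N.of_nat c.+1)%num by lia.
have -> : (N.of_nat c.+2 - 2 = N.of_nat c)%num by lia.
move: 'C(_, _) => k; lia.
Qed.

Lemma kkE c e : e < c -> kk ('C(c, 2) + e) = 'C(c, 3) + 'C(e, 2).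
Proof.
move=> lt_e_c; have c2 := bin2Z c; have c3 := bin3Z c; have e2 := bin2Z e.
rewrite /kk /kkN; set n := N.of_nat _.
have nE : (2 * Z.of_N n = Z.of_nat c * (Z.of_nat c - 1) + 2 * Z.of_nat e)%Z by lia.
set s := N.sqrt _; have [s1 s2] := N.sqrt_spec (8 * n + 1) (N.le_0_l _).
rewrite -/s in s1 s2.
(* Indeed [8 n + 1 = (2 c - 1)^2 + 8 e], which is less than [(2 c + 1)^2] as [e < c]. *)
have sc : (2 * N.of_nat c - 1 <= s <= 2 * N.of_nat c)%num by nia.
have -> : ((s + 1) / 2 = N.of_nat c)%num.
  by symmetry; apply: (N.div_unique _ _ _ (s + 1 - 2 * N.of_nat c)); lia.
rewrite bin2N bin3N (_ : n - N.of_nat 'C(c, 2) = N.of_nat e)%num; last lia.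
by rewrite bin2N; lia.
Qed.

Lemma kk_decomp n : exists c e, e < c /\ n = 'C(c, 2) + e.
Proof.
elim: n => [|n [c [e [lt_e_c ->]]]]; first by exists 1, 0.
case: (ltnP e.+1 c) => [lt|ge]; first by exists c, e.+1; lia.
by exists c.+1, 0; rewrite binS bin1; lia.
Qed.

Lemma kk_lov n : lovasz (Z.of_nat n) (Z.of_nat (kk n)).
Proof.
have [c [e [lt_e_c ->]]] := kk_decomp n; rewrite kkE //.
have c2 := bin2Z c; have c3 := bin3Z c; have e2 := bin2Z e.
by apply: (@kk_lovasz (Z.of_nat c) (Z.of_nat e)); lia.
Qed.

Lemma lovN_spec (n : N) (u : Z) :
  lovasz (Z.of_N n) u <-> (0 <= u <= Z.of_N (lovN n))%Z.
Proof.
rewrite /lovasz /lovN; set s := N.sqrt _.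
have [s1 s2] := N.sqrt_spec (n * n * (8 * n + 1)) (N.le_0_l _).
rewrite -/s in s1 s2.
(* This makes the truncated subtraction in [lovN] a genuine one. *)
have sn : (3 * n <= s)%num.
  by apply/N.sqrt_le_square; case: (N.eq_0_gt_0_cases n) => [->|]; nia.
have qd := N.div_mod (s - 3 * n) 6 ltac:(lia).
have qm := N.mod_lt (s - 3 * n) 6 ltac:(lia).
move: (_ / 6)%num (_ mod 6)%num qd qm => q r qd qm.
split=> -[u_ge0 H]; split=> //.
  have : (6 * u + 3 * Z.of_N n < Z.of_N s + 1)%Z by nia.
  by lia.
have : (6 * u + 3 * Z.of_N n <= Z.of_N s)%Z by lia.
nia.
Qed.

Lemma bnd_lov n : lovasz (Z.of_nat n) (Z.of_nat (bnd n)).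
Proof.
rewrite /bnd /bndN; case: N.ltb_spec => _; last exact: kk_lov.
by rewrite -nat_N_Z; apply/lovN_spec; lia.
Qed.

Lemma kk_le_bnd n : kk n <= bnd n.
Proof.
rewrite /bnd /bndN; case: N.ltb_spec => _ //.
by have := kk_lov n; rewrite -nat_N_Z => /lovN_spec; lia.
Qed.

Lemma bnd_kk n : 351 <= n -> bnd n = kk n.
Proof. by move=> n_ge; rewrite /bnd /bndN; case: N.ltb_spec => //; lia. Qed.

(** * The dichotomy at one vertex, for every family size *)

Lemma bin2_nat c : 2 * 'C(c, 2) + c = c * c.
Proof. by have := bin2Z c; lia. Qed.

Lemma bin2D m n : 'C(m + n, 2) = 'C(m, 2) + 'C(n, 2) + m * n.
Proof. have := bin2_nat m; have := bin2_nat n; have := bin2_nat (m + n); lia. Qed.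

Lemma bnd_add_le h : 4 <= h -> bnd h + h <= 'C(h, 2).
Proof.
rewrite leq_eqVlt => /predU1P[<- //|h_ge5].
have h_gt0 : (0 < Z.of_nat h)%Z by lia.
have := lovasz_tangent _ _ 8 1 h_gt0 (bnd_lov h).
have := bin2Z h; nia.
Qed.

(** Removing [h] sets lowers the exact bound by [C(h, 2)] plus a product, [h * (e - h)] or
    [(h - e) * (c - 1 - h)]. For [h >= 4], [bnd_add_le] gives [p + x <= C(h, 2)]; smaller [h] may
    lack one unit. *)
Lemma bnd_step_near c e h p x y : 36 <= c -> e < c -> 0 < h < c ->
  p <= bnd h -> x <= h -> y <= bnd ('C(c, 2) + e - h) ->
  (0 < x -> y < bnd ('C(c, 2) + e - h).+1) -> p + x + y <= 'C(c, 3) + 'C(e, 2).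
Proof.
move=> c_ge lt_e_c /andP[h_gt0 lt_h_c] pb xh.
have bndE c' e' : 28 <= c' -> e' < c' -> bnd ('C(c', 2) + e') = 'C(c', 3) + 'C(e', 2).
  move=> c'_ge lt_e'; rewrite bnd_kk ?kkE //.
  by have := bin2_nat c'; nia.
(* For [h = 1, 2, 3] the sum [bnd h + h] exceeds [C(h, 2)] by exactly one. *)
have small_h : 4 <= h \/ [/\ bnd h + h <= 'C(h, 2) + 1, bnd h <= 'C(h, 2) & h < 4].
  by case: h h_gt0 {lt_h_c pb xh} => [|[|[|[|h]]]] // _; [right|right|right|left].
have [le_h_e|lt_e_h] := leqP h e.
  have [k eE] : exists k, e = h + k by exists (e - h); rewrite subnKC.
  rewrite eE (_ : 'C(c, 2) + (h + k) - h = 'C(c, 2) + k); last lia.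
  rewrite bndE; try lia.
  rewrite bin2D => yb ext; case: small_h => [/bnd_add_le|[sh1 sh2 h_lt4]]; first lia.
  (* A positive product [h * k] supplies the missing unit. If [k = 0], it comes from [ext], because
     the bound is the same at [C(c, 2)] and [C(c, 2) + 1]. *)
  case: (posnP k) => [k0|k_gt0]; last nia.
  move: ext; rewrite k0 addn0 -[in bnd _]addn1 bndE; try lia.
  by move: yb; rewrite k0 (_ : 'C(0, 2) = 0) // (_ : 'C(1, 2) = 0) //; lia.
case: c c_ge lt_e_c lt_h_c => // c c_ge lt_e_c lt_h_c.
have [k hE] : exists k, h = e + k by exists (h - e); rewrite subnKC // ltnW.
have [j cE] : exists j, c = e + k + j by exists (c - h); rewrite -hE subnKC.
have -> : 'C(c.+1, 2) + e - h = 'C(c, 2) + (c - k) by rewrite binS bin1; lia.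
rewrite bndE ?binS; try lia.
have -> : c - k = e + j by lia.
have := bin2D (e + j) k; rewrite (_ : e + j + k = c); last lia.
move=> -> yb _; case: small_h => [/bnd_add_le|[sh1 sh2 h_lt4]].
  by move: pb xh; rewrite hE bin2D; nia.
have kj : 0 < k * j by rewrite muln_gt0; lia.
by move: sh1; rewrite [in 'C(h, 2)]hE bin2D; lia.
Qed.

(** Computation settles [b < 630]. Above that, the cases are [d] up to about [4 c / 3], [d] up to
    [c^2 / 8], then [b - d >= c] and finally [b - d < c]. *)
Lemma bnd_step b d p x y : 0 < d < b -> p <= bnd (b - d) -> x <= b - d -> y <= bnd d ->
  x + 3 * y <= 'C(d, 2) -> (0 < x -> y < bnd d.+1) ->
  p + x + y <= bnd b \/ b * (x + 3 * y) <= 2 * d * bnd b.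
Proof.
move=> d_bd pb xh yb pairs ext.
have [b_lt|b_ge] := ltnP b 630.
  have chk := table_check table_true d_bd (b_lt : b <= 629).
  have lt_d_b : (N.of_nat d < N.of_nat b)%num by lia.
  have := check_sound (p := N.of_nat p) (x := N.of_nat x) (y := N.of_nat y) lt_d_b chk.
  move: pb yb ext; rewrite /bnd.
  move: (bndN (N.of_nat b)) (bndN (N.of_nat (b - d))) (bndN (N.of_nat d)) (bndN (N.of_nat d.+1)).
  have := bin2Z d; move: 'C(d, 2) pairs => q pairs dq B1 B2 B3 B4 pb yb ext.
  have -> : (N.of_nat d - 1 = N.of_nat d.-1)%num by lia.
  case; try lia.
  have [k dE] : exists k, d = k.+1 by exists d.-1; lia.
  by rewrite dE succnK in dq *; lia.
have [c [e [lt_e_c bE]]] := kk_decomp b.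
have c2 := bin2Z c; have c3 := bin3Z c; have e2 := bin2Z e; have d2 := bin2Z d.
have c_ge : 36 <= c.
  rewrite leqNgt; apply/negP => c_lt; have := bin2_nat c.
  by have : c * c <= 35 * 35 by [apply: leq_mul]; lia.
have bF : bnd b = 'C(c, 3) + 'C(e, 2) by rewrite bnd_kk ?bE ?kkE //; lia.
rewrite bF; set F := 'C(c, 3) + 'C(e, 2).
have Hc : (36 <= Z.of_nat c)%Z by lia.
have He : (0 <= Z.of_nat e < Z.of_nat c)%Z by lia.
have Hb : (2 * Z.of_nat b = Z.of_nat c * (Z.of_nat c - 1) + 2 * Z.of_nat e)%Z by lia.
have HF : (6 * Z.of_nat F = Z.of_nat c * (Z.of_nat c - 1) * (Z.of_nat c - 2)
   + 3 * Z.of_nat e * (Z.of_nat e - 1))%Z.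
  by rewrite /F; lia.
have [small|mid] := leqP (6 * d + 13) (8 * c).
  right; have H : (Z.of_nat b * Z.of_nat (x + 3 * y) <= 2 * Z.of_nat d * Z.of_nat F)%Z; last lia.
  by apply: (ratio_small _ _ _ _ Hc He Hb HF); lia.
have [d_le|d_gt] := leqP (8 * d) (c * c).
  right; have H : (Z.of_nat b * Z.of_nat (x + 3 * y) <= 2 * Z.of_nat d * Z.of_nat F)%Z; last lia.
  by apply: (ratio_mid _ _ _ _ Hc He Hb HF _ _ _ _ _ (bnd_lov d)); lia.
left; have [h_ge|h_lt] := leqP c (b - d).
  have H : (Z.of_nat (bnd (b - d)) + Z.of_nat (b - d) + Z.of_nat (bnd d) <= Z.of_nat F)%Z; last lia.
  by apply: (sum_large _ _ _ _ Hc He Hb HF _ _ _ _ _ _ _ (bnd_lov d) (bnd_lov (b - d))); lia.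
apply: (@bnd_step_near c e (b - d)) => //; first by lia.
  by rewrite -bE subKn //; lia.
by rewrite -bE subKn //; lia.
Qed.

(** * Links and deletions *)

Section Families.
Variable T : finType.
Implicit Types (A B : {set {set T}}) (X Y Z : {set T}) (v : T).

Definition below B X := [set Y in B | Y \subset X].

(* The ranks are [s.+1] and [s], that is, [r = s.+1]. *)
Definition shadowed s k A B :=
  [/\ forall X, X \in A -> #|X| = s.+1, forall Y, Y \in B -> #|Y| = s
    & forall X, X \in A -> k <= #|below B X|].

Definition link v B := [set Y : {set T} | (v \notin Y) && (v |: Y \in B)].
Definition del v B := [set Y in B | v \notin Y].

Lemma link_inj v B : {in link v B &, injective (fun Y => v |: Y)}.
Proof.
move=> Y Y'; rewrite !inE => /andP[vY _] /andP[vY' _] eqY.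
by rewrite -(setU1K vY) eqY setU1K.
Qed.

Lemma star_link v B : [set Y in B | v \in Y] = [set v |: Y | Y in link v B].
Proof.
apply/setP => Y; rewrite inE; apply/andP/imsetP => [[YB vY]|[Z]].
  exists (Y :\ v); last by rewrite setD1K.
  by rewrite inE setD11 setD1K.
by rewrite inE => /andP[_ ZB] ->; rewrite setU11.
Qed.

Lemma card_star v B : #|[set Y in B | v \in Y]| = #|link v B|.
Proof. by rewrite star_link (card_in_imset (@link_inj v B)). Qed.

Lemma card_link_del v B : #|B| = #|link v B| + #|del v B|.
Proof.
rewrite -card_star -(cardsID [set Y : {set T} | v \in Y] B); congr addn.
  by apply: eq_card => Y; rewrite !inE.
by apply: eq_card => Y; rewrite !inE andbC.
Qed.

Lemma link_below B v X : v \notin X ->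
  link v (below B (v |: X)) = below (link v B) X.
Proof.
move=> vX; apply/setP => Y; rewrite !inE; case vY: (v \in Y) => //=.
congr andb; apply/idP/idP => [sub|]; last exact: setUS.
by rewrite -(setU1K (negbT vY)) -(setU1K vX) setSD.
Qed.

(** The only [s]-subset of [v |: X] that avoids [v] is [X] itself. *)
Lemma below_link s B v X : (forall Y, Y \in B -> #|Y| = s) -> #|X| = s -> v \notin X ->
  #|below B (v |: X)| = #|below (link v B) X| + (X \in B).
Proof.
move=> uB cX vX; rewrite (card_link_del v) link_below //; congr addn.
rewrite (_ : del v _ = if X \in B then [set X] else set0); last first.
  apply/setP => Y; rewrite !inE.
  case: (eqVneq Y X) => [->|neYX].
    by case: ifP => XB; rewrite ?inE ?eqxx // subsetUr vX.
  transitivity false; last by case: ifP; rewrite !inE ?(negbTE neYX).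
  apply/negbTE/negP => /andP[/andP[YB sYX] vY]; case/negP: neYX.
  rewrite eqEcard cX (uB _ YB) leqnn andbT.
  apply/subsetP => z zY; have:= subsetP sYX z zY.
  by rewrite !inE => /predU1P[zv|//]; rewrite zv (negbTE vY) in zY.
by case: ifP => _; rewrite ?cards1 ?cards0.
Qed.

(* Two distinct [s]-sets lie in at most one common [s.+1]-set, their union. *)
Lemma sum_pairs_below s A B : (forall X, X \in A -> #|X| = s.+1) ->
  (forall Y, Y \in B -> #|Y| = s) ->
  \sum_(X in A) 'C(#|below B X|, 2) <= 'C(#|B|, 2).
Proof.
move=> uA uB; rewrite -cards_draws.
set P := [set _ | _].
have -> : \sum_(X in A) 'C(#|below B X|, 2) =
          \sum_(X in A) \sum_(Q in P) (Q \subset below B X).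
  apply: eq_bigr => X _; rewrite -cards_draws -sum1_card.
  rewrite [RHS]big_mkcond /= [LHS]big_mkcond /=; apply: eq_bigr => Q _; rewrite !inE.
  case: (boolP (Q \subset below B X)) => sQ; last by case: ifP.
  have -> : Q \subset B by apply: subset_trans sQ _; apply/subsetP => Y; rewrite inE => /andP[].
  by case: ifP.
rewrite exchange_big -sum1_card; apply: leq_sum => Q; rewrite inE => /andP[sQB cQ].
have /cards2P[Y [Y' [nYY' eQ]]] := cQ.
have YB : Y \in B by rewrite (subsetP sQB) // eQ set21.
have YB' : Y' \in B by rewrite (subsetP sQB) // eQ set22.
have unionE X : X \in A -> Q \subset below B X -> X = Y :|: Y'.
  move=> XA /subsetP sQ.
  have:= sQ Y; have:= sQ Y'; rewrite eQ set21 set22 !inE.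
  move=> /(_ isT)/andP[_ sY'] /(_ isT)/andP[_ sY]; apply/eqP.
  rewrite eq_sym eqEcard subUset sY sY' (uA _ XA) /=.
  rewrite -(uB _ YB) ltn_neqAle subset_leq_card ?subsetUl // andbT.
  apply: contra nYY' => /eqP eqc.
  have eY : Y = Y :|: Y' by apply/eqP; rewrite eqEcard subsetUl -eqc leqnn.
  by rewrite eq_sym eqEcard (uB _ YB) (uB _ YB') leqnn eY subsetUr.
rewrite -big_mkcondr sum1_card.
rewrite -(cards1 (Y :|: Y')) subset_leq_card //; apply/subsetP => X.
by rewrite !inE => /andP[XA sX]; apply/eqP/unionE.
Qed.

Lemma sum_link_card s B : (forall Y, Y \in B -> #|Y| = s) ->
  \sum_v #|link v B| = s * #|B|.
Proof.
move=> uB; transitivity (\sum_(Y in B) #|Y|); last first.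
  by rewrite (eq_bigr _ uB) sum_nat_const mulnC.
under eq_bigr => v _ do rewrite -card_star -sum1_card big_mkcond /=.
rewrite exchange_big [RHS]big_mkcond; apply: eq_bigr => Y _ /=.
case: ifP => YB; last by rewrite big1 // => v _; rewrite inE YB.
by rewrite -sum1_card [RHS]big_mkcond /=; apply: eq_bigr => v _; rewrite inE YB.
Qed.

Lemma card_below_le s B X : (forall Y, Y \in B -> #|Y| = s) -> #|X| = s.+1 ->
  #|below B X| <= s.+1.
Proof.
move=> uB cX; have <- : 'C(s.+1, s) = s.+1 by rewrite -bin_sub // subSnn bin1.
rewrite -cX -cards_draws; apply/subset_leq_card/subsetP => Y.
by rewrite !inE => /andP[/uB -> ->]; rewrite eqxx.
Qed.

Lemma shadowed_small s k A B : s.+1 < k -> shadowed s k A B -> A = set0.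
Proof.
move=> lt_s_k [uA uB sh]; apply/setP => X; rewrite inE; apply/negP => XA.
by have := leq_trans (sh X XA) (card_below_le uB (uA X XA)); rewrite leqNgt lt_s_k.
Qed.

Lemma link_uniform s B v Y : (forall Z, Z \in B -> #|Z| = s.+1) -> Y \in link v B -> #|Y| = s.
Proof. by move=> uB; rewrite inE => /andP[vY /uB]; rewrite cardsU1 vY => -[]. Qed.

Lemma del_shadowed s k A B v : shadowed s k A B -> shadowed s k (del v A) (del v B).
Proof.
case=> uA uB sh; split=> [X|Y|X]; rewrite inE => /andP[]; auto.
move=> XA vX; apply: leq_trans (sh X XA) _; apply/subset_leq_card/subsetP => Y.
rewrite !inE => /andP[-> sYX]; rewrite sYX !andbT.
by apply: contra vX; apply: (subsetP sYX).
Qed.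

(* The members of [A] through [v], with [v] removed, split according to
   whether at least three of their members of [B] pass through [v]. *)
Definition full v A B := [set X in link v A | 2 < #|below (link v B) X|].
Definition part v A B := [set X in link v A | #|below (link v B) X| <= 2].

Lemma card_full_part v A B : #|A| = #|del v A| + #|part v A B| + #|full v A B|.
Proof.
rewrite (card_link_del v A) addnC -addnA; congr addn.
rewrite -(cardsID [set X | #|below (link v B) X| <= 2]); congr addn; apply: eq_card => X.
  by rewrite !inE.
by rewrite !inE -ltnNge andbC.
Qed.

(** * Counts at a fixed vertex *)

Section Vertex.
Variables (s : nat) (A B : {set {set T}}) (v : T).
Hypothesis shAB : shadowed s.+1 3 A B.

Lemma full_shadowed : shadowed s 3 (full v A B) (link v B).
Proof.
have [uA uB sh] := shAB; split=> [X|Y|X].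
- by rewrite inE => /andP[/(link_uniform uA)].
- exact: link_uniform.
- by rewrite inE => /andP[].
Qed.

(** Of the at least three members of [B] below [v |: X], at most two contain [v], and only [X] can
    avoid it. *)
Lemma partP X : X \in part v A B -> X \in del v B /\ #|below (link v B) X| = 2.
Proof.
have [uA uB sh] := shAB; rewrite !inE => /andP[/andP[vX XA] le2].
have cX : #|X| = s.+1 by have := uA _ XA; rewrite cardsU1 vX => -[].
have := sh _ XA; rewrite (below_link uB cX vX) vX andbT.
by move: le2; case: (X \in B) => /=; lia.
Qed.

Lemma card_part_le : #|part v A B| <= #|del v B|.
Proof. by apply/subset_leq_card/subsetP => X /partP[]. Qed.

(** In the pair count for the link, a set of [part] contributes one pair and a set of [full] at
    least [C(3, 2) = 3]. *)
Lemma part_full_pairs : #|part v A B| + 3 * #|full v A B| <= 'C(#|link v B|, 2).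
Proof.
have [uA uB sh] := shAB.
apply: leq_trans (@sum_pairs_below s (link v A) _ _ _); try by move=> X; exact: link_uniform.
rewrite (bigID [pred X | #|below (link v B) X| <= 2]) /=; apply: leq_add.
  rewrite -sum1_card; under eq_bigl => X do rewrite inE.
  apply: leq_sum => X XP; have [|_ ->] // := @partP X.
  by rewrite inE.
rewrite mulnC -sum_nat_const (eq_bigl (fun X => X \in full v A B)); last first.
  by move=> X; rewrite !inE ltnNge.
apply: leq_sum => X; rewrite inE => /andP[_ gt2].
by rewrite -[3]/('C(3, 2)) leq_bin2l.
Qed.

(* A counted set contains at least three [s]-sets, and only two of them are in
   the link; adding a third to the link turns it into a full one. *)
Lemma part_extend : 1 < s -> 0 < #|part v A B| -> exists A' B',
  [/\ shadowed s 3 A' B', #|A'| = #|full v A B|.+1 & #|B'| = #|link v B|.+1].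
Proof.
have [uA uB sh] := shAB; have [fA fB fsh] := full_shadowed.
move=> s_gt1 /card_gt0P[X Xp]; have [XB cX2] := partP Xp.
have cX : #|X| = s.+1 by apply: uB; move: XB; rewrite inE => /andP[].
have [Z [sZX cZ ZB]] : exists Z : {set T}, [/\ Z \subset X, #|Z| = s & Z \notin link v B].
  have : 0 < #|[set Z : {set T} | Z \subset X & #|Z| == s] :\: link v B|.
    rewrite cardsD cards_draws cX -(bin_sub (leqnSn s)) subSnn bin1 subn_gt0.
    apply: leq_ltn_trans (_ : 2 < s.+1) => //; rewrite -cX2; apply/subset_leq_card.
    by apply/subsetP => Z; rewrite !inE => /andP[/andP[-> _] ->].
  by case/card_gt0P => Z; rewrite in_setD inE => /and3P[ZB sZX /eqP cZ]; exists Z; split.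
exists (X |: full v A B), (Z |: link v B); split.
- split=> [Y /setU1P[->|/fA]|Y /setU1P[->|/fB]|Y /setU1P[->|YF]] //.
    rewrite -[2]cX2 (_ : below (Z |: _) X = Z |: below (link v B) X).
      by rewrite cardsU1 inE (negbTE ZB).
    by apply/setP => W; rewrite !inE; case: eqP => [->|]; rewrite ?sZX.
  apply: leq_trans (fsh Y YF) _; apply/subset_leq_card/subsetP => W.
  by rewrite !inE => /andP[-> ->]; rewrite orbT.
- by rewrite cardsU1 inE cX2 ltnn andbF.
- by rewrite cardsU1 ZB.
Qed.

End Vertex.

(* At most three vertices of [X] lie in at most two of the members of [B] below
   [X], since each is missed by one of those members, and there are only three. *)
Lemma sum_part_full s A B : shadowed s.+1 3 A B ->
  3 * s * #|A| <= \sum_v (#|part v A B| + 3 * #|full v A B|).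
Proof.
case=> uA uB sh; pose g v X := if 2 < #|[set Y in below B X | v \in Y]| then 3 else 1.
have -> : \sum_v (#|part v A B| + 3 * #|full v A B|) = \sum_(X in A) \sum_(v in X) g v X.
  transitivity (\sum_v \sum_(X in A | v \in X) g v X); last first.
    rewrite (exchange_big_dep (mem A)) /= => [|v X _ /andP[]//].
    by apply: eq_bigr => X XA; apply: eq_bigl => v; rewrite XA.
  apply: eq_bigr => v _.
  transitivity (\sum_(X in [set X in A | v \in X]) g v X); last first.
    by apply: eq_bigl => X; rewrite inE.
  rewrite star_link big_imset /=; last exact: link_inj.
  have gE X : X \in link v A -> g v (v |: X) = if 2 < #|below (link v B) X| then 3 else 1.
    by rewrite inE /g => /andP[vX _]; rewrite card_star link_below.
  rewrite (eq_bigr _ gE) (bigID [pred X | #|below (link v B) X| <= 2]) /=; congr addn.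
    rewrite -sum1_card; under eq_bigl => X do rewrite inE.
    by apply: eq_bigr => X /andP[_]; rewrite ltnNge => ->.
  rewrite mulnC -sum_nat_const; apply: eq_big => X; first by rewrite !inE ltnNge.
  by rewrite inE => /andP[_ ->].
rewrite mulnC -sum_nat_const; apply: leq_sum => X XA.
have cX := uA _ XA; set D := below B X; have D_ge3 : 2 < #|D| := sh _ XA.
(* The vertices of weight 1. As [X] has [s + 2] vertices, [#|t| <= 3] gives total weight at least
   [3 (s + 2) - 6 = 3 s]. *)
pose t := [set v in X | #|[set Y in D | v \in Y]| <= 2].
have sumE : \sum_(v in X) g v X + 2 * #|t| = 3 * #|X|.
  rewrite [RHS]mulnC -sum_nat_const -sum1_card big_distrr /=.
  rewrite [X in _ + X](_ : _ = \sum_(v in X) 2 * (v \in t)).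
    rewrite -big_split; apply: eq_bigr => v vX /=; rewrite /g inE vX /=.
    by rewrite -/D; case: leqP.
  rewrite [RHS](bigID (mem t)) /= [X in _ = _ + X]big1 ?addn0; last by move=> v /andP[_ /negbTE ->].
  apply: eq_big => v; last by move=> ->.
  by rewrite inE; case: (v \in X).
have missing v : v \in t -> [set Y in D | v \notin Y] \subset [set X :\ v].
  rewrite inE => /andP[vX _]; apply/subsetP => Y; rewrite !inE => /andP[/andP[YB sYX] vY].
  rewrite eqEcard subsetD1 sYX vY /= (uB _ YB).
  by have := cardsD1 v X; rewrite vX cX; lia.
have cardD v : #|D| = #|[set Y in D | v \in Y]| + #|[set Y in D | v \notin Y]|.
  by rewrite card_star (card_link_del v).
have t_le3 : #|t| <= 3.
  have [->|[v vt]] := set_0Vmem t; first by rewrite cards0.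
  have D_le3 : #|D| <= 3.
    rewrite (cardD v); have := subset_leq_card (missing v vt); rewrite cards1.
    by move: vt; rewrite inE => /andP[_]; lia.
  apply: leq_trans D_le3; have inj : {in t &, injective (fun v => X :\ v)}.
    move=> u w; rewrite !inE => /andP[uX _] /andP[wX _] /setP/(_ u).
    by rewrite !inE eqxx uX /= andbT => /esym/negbFE/eqP.
  rewrite -(card_in_imset inj); apply/subset_leq_card/subsetP => _ /imsetP[w wt ->].
  have := missing w wt; rewrite subset1 => /orP[]/eqP eqD.
    by have:= set11 (X :\ w); rewrite -eqD inE => /andP[].
  move: (D_ge3) (wt); rewrite (cardD w) eqD cards0 inE => + /andP[_]; lia.
lia.
Qed.

End Families.

(** The slack is [d * (e - d)] if [d <= e], and [(d - e) * (c - 1 - d)] otherwise. *)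
Lemma kk_step c e d : e < c -> d < c -> d <= 'C(c, 2) + e ->
  kk ('C(c, 2) + e - d) + 'C(d, 2) <= kk ('C(c, 2) + e).
Proof.
move=> lt_e_c lt_d_c le_d; rewrite (kkE lt_e_c).
have [le_d_e|lt_e_d] := leqP d e.
  have [k eE] : exists k, e = d + k by exists (e - d); rewrite subnKC.
  rewrite -addnBA // kkE; last by lia.
  by rewrite eE addKn bin2D; lia.
case: c lt_e_c lt_d_c le_d => // c lt_e_c lt_d_c _.
have [k dE] : exists k, d = e + k by exists (d - e); rewrite subnKC // ltnW.
have [j cE] : exists j, c = e + k + j by exists (c - d); rewrite -dE subnKC.
have -> : 'C(c.+1, 2) + e - d = 'C(c, 2) + (c - k) by rewrite binS bin1; lia.
rewrite kkE ?binS; try lia.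
have -> : c - k = e + j by lia.
have := bin2D (e + j) k; rewrite (_ : e + j + k = c); last lia.
by rewrite dE (bin2D e k); lia.
Qed.

(** * The upper bounds *)

Section Upper.
Variable T : finType.
Implicit Types (A B : {set {set T}}) (v : T).

(** If all nonzero degrees were at least [c], a vertex and its neighbours would give more than [c]
    such vertices, so [2 #|B| >= c (c + 1)], contradicting [e < c]. *)
Lemma graph_small_degree B c e : (forall Y, Y \in B -> #|Y| = 2) -> e < c ->
  #|B| = 'C(c, 2) + e -> 0 < #|B| -> exists2 v, 0 < #|link v B| & #|link v B| < c.
Proof.
move=> uB lt_e_c cB B_gt0; case: (boolP [exists v, (0 < #|link v B|) && (#|link v B| < c)]).
  by case/existsP => v /andP[]; exists v.
move=> /existsPn none; have large v : 0 < #|link v B| -> c <= #|link v B|.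
  by move=> d_gt0; have := none v; rewrite d_gt0 /= -leqNgt.
pose W := [set v | 0 < #|link v B|].
have sumE := sum_link_card uB.
have [w wW] : exists w, w \in W.
  apply/set0Pn; apply: contraTneq B_gt0 => W0.
  move: sumE; rewrite big1 => [|v _]; first lia.
  by apply/eqP; rewrite -leqn0 leqNgt; apply/negP => dv; have := in_set0 v; rewrite -W0 inE dv.
have deg_w : #|link w B| <= #|W :\ w|.
  apply: leq_trans (leq_imset_card (fun u => [set u]) _); apply/subset_leq_card/subsetP => Y.
  rewrite inE => /andP[wY YB]; have := uB _ YB; rewrite cardsU1 wY => -[/eqP/cards1P[u eY]].
  rewrite eY mem_imset; last exact: set1_inj.
  rewrite eY inE in wY YB *; rewrite !inE eq_sym wY /=.
  apply/card_gt0P; exists [set w]; rewrite inE inE eq_sym wY /= setUC.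
  exact: YB.
have W_gt : c < #|W|.
  have := cardsD1 w W; rewrite wW => ->; rewrite ltnS (leq_trans _ deg_w) //.
  by apply: large; move: wW; rewrite inE.
have : #|W| * c <= 2 * #|B|.
  rewrite -sumE -sum_nat_const big_mkcond /=; apply: leq_sum => v _.
  by case: ifP => //; rewrite inE => /large.
rewrite cB; have := bin2_nat c; nia.
Qed.

Lemma graph_bound A B : shadowed 2 3 A B -> #|A| <= kk #|B|.
Proof.
have [n leBn] := ubnP #|B|; elim: n => // n IH in A B leBn *.
move=> sh; have [uA uB shA] := sh.
have [B0|B_gt0] := posnP #|B|.
  case: (set_0Vmem A) => [->|[X XA]]; first by rewrite cards0.
  have := shA X XA; have : #|below B X| <= #|B|.
    by apply/subset_leq_card/subsetP => Y; rewrite inE => /andP[].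
  lia.
have [c [e [lt_e_c cB]]] := kk_decomp #|B|.
have [v d_gt0 d_lt] := graph_small_degree uB lt_e_c cB B_gt0.
have cA := card_link_del v A; have cBv := card_link_del v B.
(* A triangle through [v] has at most one edge avoiding [v], hence uses a pair of edges at [v]. *)
have linkA : #|link v A| <= 'C(#|link v B|, 2).
  have uL := (@link_uniform _ 1 B v); have uLA := (@link_uniform _ 2 A v).
  apply: leq_trans (@sum_pairs_below _ 1 (link v A) (link v B) _ _) => //; last 2 first.
  - by move=> X; apply: uLA.
  - by move=> Y; apply: uL.
  rewrite -sum1_card; apply: leq_sum => X XL; rewrite bin_gt0.
  have cX := uLA X uA XL; move: XL; rewrite inE => /andP[vX XA].
  by have := shA _ XA; rewrite (below_link uB cX vX); case: (_ \in _) => /=; lia.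
have delA : #|del v A| <= kk #|del v B|.
  by apply: IH (del_shadowed v sh); lia.
rewrite cA addnC [in X in _ <= X]cB.
apply: leq_trans (_ : kk ('C(c, 2) + e - #|link v B|) + 'C(#|link v B|, 2) <= _).
  by rewrite -cB [X in kk (X - _)]cBv addKn leq_add.
by apply: kk_step => //; rewrite -cB cBv leq_addr.
Qed.

Lemma shadowed3_bound s A B : shadowed s 3 A B -> #|A| <= bnd #|B|.
Proof.
have [n leBn] := ubnP #|B|; elim: n => // n IHB in s A B leBn *.
elim: s => [|s IHs] in A B leBn *; first by move/shadowed_small => -> //; rewrite cards0.
have [->|s_gt0] := posnP s; first by move/shadowed_small => -> //; rewrite cards0.
move=> sh; have [uA uB shA] := sh.
(* The two inductions combined: links drop in rank, deletions keep the rank but have fewer sets. *)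
have IH t A' B' : t = s \/ #|B'| < #|B| -> #|B'| <= #|B| -> shadowed t 3 A' B' ->
    #|A'| <= bnd #|B'|.
  move=> [->|lt_B'] le_B'; first by apply: IHs; apply: leq_ltn_trans leBn.
  by apply: IHB; apply: leq_trans lt_B' _.
case: (ltnP 1 s) => [s_gt1|s_le1]; last first.
  have s1 : s = 1 by lia.
  by rewrite s1 in sh; apply: leq_trans (graph_bound sh) (kk_le_bnd _).
rewrite leqNgt; apply/negP => gtA.
have cB v := card_link_del v B.
have ratio v : #|B| * (#|part v A B| + 3 * #|full v A B|) <= 2 * #|link v B| * bnd #|B|.
  have pairs := part_full_pairs v sh.
  have [d0|d_gt0] := posnP #|link v B|.
    by move: pairs; rewrite d0 leqn0 => /eqP ->; rewrite muln0.
  have le_dB : #|link v B| <= #|B| by rewrite (cB v) leq_addr.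
  have full_le : #|full v A B| <= bnd #|link v B|.
    by apply: (IH s) (full_shadowed v sh); [left|].
  (* Otherwise no member of [B] avoids [v], so all of [A] is counted by [full] and already obeys the
     bound. Strictness also leaves room for the link enlarged by one set. *)
  have lt_dB : #|link v B| < #|B|.
    rewrite ltn_neqAle le_dB andbT; apply/eqP => dB.
    have dB0 : #|del v B| = 0 by have := cB v; lia.
    have part0 := card_part_le v sh.
    have dA0 : #|del v A| = 0.
      apply: eq_card0 => X; apply/negP => XA; have [_ _ /(_ X XA)] := del_shadowed v sh.
      have : #|below (del v B) X| <= #|del v B|.
        by apply/subset_leq_card/subsetP => Y; rewrite inE => /andP[].
      lia.
    by move: gtA; rewrite (card_full_part v A B) -dB; lia.
  have dE : #|del v B| = #|B| - #|link v B| by rewrite (cB v) addKn.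
  have [] := @bnd_step #|B| #|link v B| #|del v A| #|part v A B| #|full v A B|.
  - by rewrite d_gt0.
  - by rewrite -dE; apply: IH (del_shadowed v sh); [right|]; rewrite (cB v); lia.
  - by rewrite -dE; apply: card_part_le sh.
  - exact: full_le.
  - exact: pairs.
  - move=> /(part_extend sh s_gt1)[A' [B' [sh' <- cB']]].
    by rewrite -cB'; apply: (IH s) sh'; [left|rewrite cB'].
  - by rewrite -(card_full_part v A B) leqNgt gtA.
  - by [].
have lower := sum_part_full sh; have deg := sum_link_card uB.
have : \sum_v #|B| * (#|part v A B| + 3 * #|full v A B|) <= \sum_v 2 * #|link v B| * bnd #|B|.
  by apply: leq_sum => v _.
rewrite -big_distrr -big_distrl -big_distrr /= deg => upper.
have B_gt0 : 0 < #|B|.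
  have /card_gt0P[X XA] : 0 < #|A| by apply: leq_ltn_trans gtA.
  have : #|below B X| <= #|B|.
    by apply/subset_leq_card/subsetP => Y; rewrite inE => /andP[].
  by have := shA X XA; lia.
have : #|B| * (3 * s * #|A|) <= 2 * (s.+1 * #|B|) * bnd #|B|.
  by apply: leq_trans upper; rewrite leq_mul2l lower orbT.
rewrite (_ : 2 * (s.+1 * #|B|) * bnd #|B| = #|B| * (2 * s.+1 * bnd #|B|)); last by lia.
rewrite leq_pmul2l // leqNgt => /negP[].
(* Here [2 (s + 1) <= 3 s] because [s >= 2]. *)
apply: leq_ltn_trans (_ : 3 * s * bnd #|B| < _); first by rewrite leq_mul2r; lia.
by rewrite ltn_pmul2l //; lia.
Qed.
End Upper.

(** * From finite types to sets of natural numbers *)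

Section Transfer.
Local Open Scope fset_scope.
Variables (T : finType) (f : T -> nat).
Hypothesis f_inj : injective f.
Implicit Types (A B : {set {set T}}) (S X Y : {set T}).

Definition fset_of S : {fset nat} := [fset f x | x in S].
Definition family_of B : {fset {fset nat}} := [fset fset_of S | S in B].

Lemma mem_fset_of S x : (f x \in fset_of S) = (x \in S).
Proof. by rewrite (mem_imfset _ _ f_inj). Qed.

Lemma fset_of_sub X Y : (fset_of X `<=` fset_of Y) = (X \subset Y).
Proof.
apply/fsubsetP/subsetP => [sXY x xX|sXY _ /imfsetP[x /= xX ->]].
  by rewrite -mem_fset_of sXY // mem_fset_of.
by rewrite mem_fset_of sXY.
Qed.

Lemma fset_of_inj : injective fset_of.
Proof. by move=> X Y eqXY; apply/setP => x; rewrite -!mem_fset_of eqXY. Qed.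

Lemma card_fset_of S : #|` fset_of S| = #|S|.
Proof. by rewrite card_imfset //= -cardE. Qed.

Lemma mem_family_of B S : (fset_of S \in family_of B) = (S \in B).
Proof. by rewrite (mem_imfset _ _ fset_of_inj). Qed.

Lemma card_family_of B : #|` family_of B| = #|B|.
Proof. by rewrite card_imfset ?[RHS]cardE //; apply: fset_of_inj. Qed.

Lemma below_family_of B X :
  [fset Y in family_of B | Y `<=` fset_of X] = family_of (below B X).
Proof.
apply/fsetP => Z; rewrite !inE /=; apply/andP/imfsetP => [[/imfsetP[Y /= YB ->] sYX]|].
  by exists Y => //=; rewrite inE YB -fset_of_sub.
by case=> Y /=; rewrite inE => /andP[YB sYX] ->; rewrite mem_family_of fset_of_sub.
Qed.

Lemma admissible_family_of s k A B :
  shadowed s k A B <-> admissible s.+1 k (family_of A) (family_of B).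
Proof.
split=> [[uA uB sh]|[uA uB _ sh]]; split=> //.
- by move=> _ /imfsetP[X /= XA ->]; rewrite card_fset_of uA.
- by move=> _ /imfsetP[X /= XB ->]; rewrite card_fset_of uB.
- by move=> _ /imfsetP[X /= XA ->]; rewrite below_family_of card_family_of sh.
- by move=> X XA; rewrite -card_fset_of uA // mem_family_of.
- by move=> X XB; rewrite -card_fset_of uB // mem_family_of.
- by move=> X XA; rewrite -card_family_of -below_family_of sh // mem_family_of.
Qed.

Lemma family_ofP (F : {fset {fset nat}}) :
  (forall Z : {fset nat}, Z \in F -> forall x, x \in Z -> exists y, x = f y) ->
  exists B, F = family_of B.
Proof.
move=> ranF; exists [set S | fset_of S \in F]; apply/fsetP => X; apply/idP/imfsetP => [XF|].
  have eX : X = fset_of [set y | f y \in X].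
    apply/fsetP => x; apply/idP/imfsetP => [xX|[y /=]]; last by rewrite inE => ? ->.
    by have [y ey] := ranF X XF x xX; exists y => //=; rewrite inE -ey.
  by exists [set y | f y \in X] => //=; rewrite inE -eX.
by case=> S /=; rewrite inE => SF ->.
Qed.

End Transfer.

(** Only finitely many numbers occur in the two families, so an initial segment ['I_n] contains them
    all. *)
Lemma admissible_ordinal s k (A B : {fset {fset nat}}) : admissible s.+1 k A B ->
  exists n (A' B' : {set {set 'I_n}}),
    [/\ shadowed s k A' B', #|` A|%fset = #|A'| & #|` B|%fset = #|B'|].
Proof.
pose n := (\max_(X <- (A `|` B)%fset) \max_(x <- X) x).+1.
have ran F : (F `<=` A `|` B)%fset -> exists C : {set {set 'I_n}}, F = family_of val C.
  move=> /fsubsetP sF; apply: family_ofP => X XF x xX.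
  have lt_x_n : x < n.
    rewrite ltnS; apply: (@leq_trans (\max_(y <- X) y)).
      by apply: (@leq_bigmax_seq _ (enum_fset X) xpredT id).
    by apply: (@leq_bigmax_seq _ (enum_fset (A `|` B)%fset) xpredT
      (fun Z : {fset nat} => \max_(y <- Z) y)); first exact: sF.
  by exists (Ordinal lt_x_n).
have [A' ->] := ran A (fsubsetUl _ _); have [B' ->] := ran B (fsubsetUr _ _).
move=> adm; exists n, A', B'; split; first exact/(admissible_family_of (@ord_inj n)).
  exact: (card_family_of (@ord_inj n)).
exact: (card_family_of (@ord_inj n)).
Qed.

Lemma shadowed_admissible (T : finType) s k (A B : {set {set T}}) : shadowed s k A B ->
  exists A' B', [/\ admissible s.+1 k A' B', #|` A'|%fset = #|A| & #|` B'|%fset = #|B|].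
Proof.
pose f (x : T) : nat := enum_rank x; have f_inj : injective f.
  by move=> x y /ord_inj/enum_rank_inj.
move=> sh; exists (family_of f A), (family_of f B).
by split; [exact/(admissible_family_of f_inj)|exact: card_family_of|exact: card_family_of].
Qed.

(** * Extremal families *)

Section Cone.
Variable T : finType.
Implicit Types (A B : {set {set T}}) (X Y : {set T}).

Definition lift X : {set option T} := Some @: X.
Definition cone X : {set option T} := None |: lift X.

Lemma mem_lift X x : (Some x \in lift X) = (x \in X).
Proof. exact/mem_imset/Some_inj. Qed.

Lemma None_lift X : None \notin lift X.
Proof. by apply/imsetP => -[]. Qed.

Lemma lift_sub X Y : (lift X \subset lift Y) = (X \subset Y).
Proof.
apply/subsetP/subsetP => [sXY x|sXY _ /imsetP[x xX ->]]; last by rewrite mem_lift sXY.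
by rewrite -!mem_lift; apply: sXY.
Qed.

Lemma cone_sub X Y : (cone X \subset cone Y) = (X \subset Y).
Proof.
rewrite -lift_sub; apply/idP/idP => [sXY|/setUS]; last exact.
by rewrite -(setU1K (None_lift X)) -(setU1K (None_lift Y)) setSD.
Qed.

Lemma lift_sub_cone X Y : (lift X \subset cone Y) = (X \subset Y).
Proof.
rewrite -lift_sub; apply/idP/idP => [/subsetP sXY|sXY]; last exact: subset_trans (subsetUr _ _).
apply/subsetP => y yX; have := sXY y yX; rewrite inE => /orP[|//].
by rewrite inE => /eqP yN; rewrite yN (negbTE (None_lift X)) in yX.
Qed.

Lemma lift_inj : injective lift. Proof. exact/imset_inj/Some_inj. Qed.

Lemma cone_inj : injective cone.
Proof. by move=> X Y eqXY; apply/eqP; rewrite eqEsubset -!cone_sub eqXY subxx. Qed.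

Lemma card_lift X : #|lift X| = #|X|. Proof. exact/card_imset/Some_inj. Qed.

Lemma card_cone X : #|cone X| = #|X|.+1.
Proof. by rewrite cardsU1 None_lift card_lift. Qed.

Lemma cone_shadowed s k A B : shadowed s k A B ->
  shadowed s.+1 k (cone @: A) (cone @: B).
Proof.
case=> uA uB sh; split=> _ /imsetP[X XF ->].
- by rewrite card_cone uA.
- by rewrite card_cone uB.
apply: leq_trans (sh X XF) _; rewrite -(card_imset _ cone_inj).
apply/subset_leq_card/subsetP => _ /imsetP[Y YB ->]; move: YB; rewrite !inE => /andP[YB sYX].
by rewrite (mem_imset _ _ cone_inj) YB cone_sub.
Qed.

End Cone.

(** Coning raises the rank and keeps both cardinalities, so extremal families are needed only at the
    least rank, [r = k]. *)
Lemma cone_iter t s k a b (T : finType) (A B : {set {set T}}) :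
  shadowed s k A B -> #|A| = a -> #|B| = b ->
  exists (T' : finType) (A' B' : {set {set T'}}),
    [/\ shadowed (t + s) k A' B', #|A'| = a & #|B'| = b].
Proof.
move=> sh cA cB; elim: t => [|t [T' [A' [B' [sh' cA' cB']]]]]; first by exists T, A, B.
exists (option T' : finType), ((@cone T') @: A'), ((@cone T') @: B').
by split; [exact: cone_shadowed|rewrite card_imset //; exact: cone_inj
  |rewrite card_imset //; exact: cone_inj].
Qed.

Lemma admissible_exists r s k a b (T : finType) (A B : {set {set T}}) : s < r ->
  shadowed s k A B -> #|A| = a -> #|B| = b ->
  exists A' B', admissible r k A' B' /\ #|` A'|%fset = a /\ #|` B'|%fset = b.
Proof.
move=> lt_s_r sh cA cB; have [T' [A' [B' [sh' cA' cB']]]] := cone_iter (r - s.+1) sh cA cB.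
have [A2 [B2 [adm cA2 cB2]]] := shadowed_admissible sh'.
exists A2, B2; rewrite cA2 cB2 cA' cB'; split=> //.
by rewrite (_ : r = (r - s.+1 + s).+1) //; lia.
Qed.

(** * Complete and colexicographic families *)

Definition subsets (T : finType) (W : {set T}) k := [set S : {set T} | S \subset W & #|S| == k].

Lemma below_subsets (T : finType) (W X : {set T}) k : X \subset W ->
  below (subsets W k) X = subsets X k.
Proof.
move=> sXW; apply/setP => Y; rewrite !inE andbC andbA; congr andb.
by apply/andP/idP => [[]//|sYX]; rewrite sYX (subset_trans sYX).
Qed.

Lemma card_subsets_succ (T : finType) (X : {set T}) s : #|X| = s.+1 -> #|subsets X s| = s.+1.
Proof. by move=> cX; rewrite cards_draws cX -(bin_sub (leqnSn s)) subSnn bin1. Qed.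

Lemma subsets_shadowed (T : finType) (W : {set T}) s :
  shadowed s s.+1 (subsets W s.+1) (subsets W s).
Proof.
split=> X; rewrite inE => /andP[sXW /eqP cX] //.
by rewrite below_subsets // card_subsets_succ.
Qed.

(** The graph is complete on [T], with a new vertex [None] joined to [W]; the other family consists
    of its triangles. *)
Lemma colex_shadowed (T : finType) (W : {set T}) :
  shadowed 2 3 ((@lift T @: subsets setT 3) :|: (@cone T @: subsets W 2))
    ((@lift T @: subsets setT 2) :|: (@cone T @: subsets W 1)).
Proof.
split=> Z /setUP[] /imsetP[X]; rewrite inE => /andP[sXW /eqP cX] -> {Z};
  rewrite ?card_lift ?card_cone ?cX //.
  rewrite -(card_subsets_succ cX) -(card_imset _ (@lift_inj T)).
  apply/subset_leq_card/subsetP => _ /imsetP[Y + ->]; rewrite !inE => /andP[sYX cY].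
  by rewrite lift_sub sYX andbT (mem_imset _ _ (@lift_inj T)) !inE subsetT cY.
(* The three edges of a triangle through [None]: the opposite edge and the two edges at [None]. *)
apply: leq_trans (_ : #|lift X |: (@cone T @: subsets X 1)| <= _).
  rewrite cardsU1 card_imset; last exact: cone_inj.
  rewrite card_subsets_succ // addn2 ltnS ltnS lt0b.
  apply/imsetP => -[Y _ eXY]; have := None_lift X.
  by rewrite eXY setU11.
apply/subset_leq_card/subsetP => Z; rewrite !inE => /orP[/eqP ->|/imsetP[Y + ->]].
  by rewrite lift_sub_cone subxx (mem_imset _ _ (@lift_inj T)) !inE subsetT cX eqxx.
rewrite inE => /andP[sYX cY]; rewrite cone_sub sYX andbT (mem_imset _ _ (@cone_inj T)).
by rewrite !inE cY (subset_trans sYX) // orbT.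
Qed.

Lemma card_lift_cone (T : finType) (F G : {set {set T}}) :
  #|(@lift T @: F) :|: (@cone T @: G)| = #|F| + #|G|.
Proof.
rewrite cardsU (card_imset _ (@lift_inj T)) (card_imset _ (@cone_inj T)).
rewrite (_ : _ :&: _ = set0) ?cards0 ?subn0 //; apply/setP => Z; rewrite !inE.
apply/negP => /andP[/imsetP[X _ ->] /imsetP[Y _ eXY]]; have := None_lift X.
by rewrite eXY setU11.
Qed.

Lemma shadowed2_bound (T : finType) s (A B : {set {set T}}) : shadowed s 2 A B ->
  #|A| <= 'C(#|B|, 2).
Proof.
case=> uA uB sh; apply: leq_trans (sum_pairs_below uA uB).
by rewrite -sum1_card; apply: leq_sum => X XA; rewrite bin_gt0 sh.
Qed.

Theorem theorem1 (r : nat) :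
  (* (i) k = 0: for every attainable a, the minimum b is 0 *)
  (forall a : nat,
     (exists A : {fset {fset nat}}, uniform r A /\ #|` A|%fset = a) ->
     min_b r 0 a 0) /\
  (* (ii) k = 1 (requires 1 <= r) *)
  (1 <= r -> forall a : nat, min_b r 1 a (if 1 <= a then 1 else 0)) /\
  (* (iii) k = 2 (requires 2 <= r) *)
  (2 <= r -> forall b : nat, f_is r 2 b 'C(b, 2)) /\
  (* (iv) k = 3 (requires 3 <= r) *)
  (3 <= r -> forall c1 c2 : nat, c1 < c2 -> 29 <= c2 ->
     f_is r 3 ('C(c2, 2) + 'C(c1, 1)) ('C(c2, 3) + 'C(c1, 2))).
Proof.
split; [|split; [|split]].
- move=> a [A [uA cA]]; split=> //; exists A, fset0; split; last by rewrite cardfs0.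
  by split=> // X; rewrite inE.
- move=> r_gt0 a; split.
    case: posnP => [->|a_gt0].
      by exists fset0, fset0; split; [split=> // X; rewrite inE|rewrite cardfs0].
    (* The witness is [a] singletons over the empty set, coned up to rank [r]. *)
    apply: (admissible_exists r_gt0 (subsets_shadowed [set: 'I_a] 0)).
      by rewrite cards_draws cardsT card_ord bin1.
    by rewrite cards_draws bin0.
  move=> A B [_ _ _ sh] cA; case: posnP => // a_gt0.
  have /fset0Pn[X XA] : A != fset0 by rewrite -cardfs_gt0 cA.
  apply: leq_trans (sh X XA) (fsubset_leq_card _).
  by apply/fsubsetP => Y; rewrite !inE => /andP[].
- move=> r_gt1 b; split.
    have [A [B [adm [cA cB]]]] :=
      admissible_exists r_gt1 (subsets_shadowed [set: 'I_b] 1) erefl erefl.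
    by exists A, B; rewrite cA cB !cards_draws cardsT card_ord bin1.
  move=> A B; case: r r_gt1 => // s _ /admissible_ordinal[n [A' [B' [sh -> ->]]]] <-.
  exact: shadowed2_bound sh.
- move=> r_gt2 c1 c2 lt_c1_c2 c2_ge; split.
    have [W cW] : exists W : {set 'I_c2}, #|W| = c1.
      have : 0 < #|subsets [set: 'I_c2] c1| by rewrite cards_draws cardsT card_ord bin_gt0 ltnW.
      by case/card_gt0P => W; rewrite inE => /andP[_ /eqP]; exists W.
    have [A [B [adm [cA cB]]]] := admissible_exists r_gt2 (colex_shadowed W) erefl erefl.
    by exists A, B; rewrite cA cB !card_lift_cone !cards_draws cardsT card_ord cW.
  move=> A B; case: r r_gt2 => // s _ /admissible_ordinal[n [A' [B' [sh -> ->]]]] cB.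
  (* Since [c2 >= 29], [#|B|] is at least [C(29, 2) = 406], in the range where [bnd] is exact. *)
  apply: leq_trans (shadowed3_bound sh) _; rewrite cB bin1 bnd_kk ?kkE //.
  apply: leq_trans (leq_addr _ _); apply: leq_trans (leq_bin2l 2 c2_ge) => //.
Qed.
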